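(* Assume there is a constant $C_2>0$ such that for all $\Phi_1,\Phi_2\in\mathcal{M}$, $$|\ell(\Phi_1;x)-\ell(\Phi_2;x)|\le C_2\|\Phi_1-\Phi_2\|_{\mathcal{V}}\quad\text{for almost all }x\in\Omega .$$ Then for all $\varepsilon>0$, $$\mathbb{P}[\mathcal{E}_{\mathrm{gen}}>\varepsilon]\le 2\,\nu\!\left(\mathcal{M},\frac{\varepsilon}{8C_2}\right)\delta\!\left(\frac{\varepsilon}{4},N\right),$$ where $\delta(\varepsilon,N)$ is an upper bound for $\mathbb{P}[|\mathcal{J}(\Phi)-\mathcal{J}_N(\Phi)|>\varepsilon]$ (uniform in $\Phi\in\mathcal{M}$).
   Context: Let $\mathcal{V}$ be a Hilbert space and $(\Omega,\Sigma,\rho)$ a measure space with finite measure $\rho$, regarded as a probability measure after rescaling the loss. Let $\ell:\mathcal{V}\times\Omega\to\mathbb{R}$ be a loss function such that $\ell(\cdot;x)$ is continuous for all $x\in\Omega$ and $\ell(\Phi;\cdot)$ is integrable with respect to $\rho$ for every $\Phi\in\mathcal{V}$. The cost functional is $\mathcal{J}(\Phi)=\int_\Omega \ell(\Phi;x)\,\mathrm{d}\rho(x)$. Let $x^1,\dots,x^N$ be independent samples distributed according to $\rho$; the empirical cost functional is $\mathcal{J}_N(\Phi)=\frac1N\sum_{i=1}^N\ell(\Phi;x^i)$. Let $\mathcal{M}\subseteq\mathcal{V}$ be a compact set (the model class), and let $\Phi^{*(\mathcal{M})}\in\arg\min_{\Phi\in\mathcal{M}}\mathcal{J}(\Phi)$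 and $\Phi^{*(\mathcal{M},N)}\in\arg\min_{\Phi\in\mathcal{M}}\mathcal{J}_N(\Phi)$. The generalization error is $\mathcal{E}_{\mathrm{gen}}=|\mathcal{J}(\Phi^{*(\mathcal{M})})-\mathcal{J}(\Phi^{*(\mathcal{M},N)})|$. The covering number $\nu(\mathcal{M},r)$ of $\mathcal{M}\subseteq\mathcal{V}$ is the minimal number of $\|\cdot\|_{\mathcal{V}}$-open balls of radius $r$ needed to cover $\mathcal{M}$. $\mathbb{P}$ is the probability with respect to the random samples. *)

(* Defs.v *)
From HB Require Import structures.
From mathcomp Require Import all_boot all_order all_algebra.
From mathcomp Require Import all_classical all_reals all_analysis.
Set Implicit Arguments.
Unset Strict Implicit.
Unset Printing Implicit Defensive.
Import Order.TTheory GRing.Theory Num.Theory.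
Import numFieldNormedType.Exports.
Local Open Scope classical_set_scope.
Local Open Scope ring_scope.

(* Together with the completeness of V, this makes V a real Hilbert space with
   inner product dot. *)
Definition norm_from_dot (R : realType) (V : completeNormedModType R)
    (dot : {dot V for idfun}) : Prop :=
  forall v : V, `|v| ^+ 2 = dot v v.

Definition cost (R : realType) (d : measure_display) (Omega : measurableType d)
    (rho : probability Omega R) (V : Type) (l : V -> Omega -> R) (Phi : V) : R :=
  Rintegral rho setT (l Phi).

Definition empirical_cost (R : realType) (Omega V : Type) (l : V -> Omega -> R)
    (N : nat) (x : 'I_N -> Omega) (Phi : V) : R :=
  N%:R^-1 * \sum_(i < N) l Phi (x i).

Definition argmin (R : realType) (V : Type) (M : set V) (F : V -> R) : set V :=
  [set Phi | M Phi /\ forall Psi, M Psi -> F Phi <= F Psi].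

Definition coverable (R : realType) (V : normedModType R) (M : set V) (r : R)
    (n : nat) : Prop :=
  exists c : 'I_n -> V, M `<=` \bigcup_(i in [set: 'I_n]) ball (c i) r.

(* Extended-real valued, so that it is +oo when no finite cover exists; the
   centres range over all of V and need not belong to M. *)
Definition covering_number (R : realType) (V : normedModType R) (M : set V)
    (r : R) : \bar R :=
  ereal_inf [set n%:R%:E | n in coverable M r].

Definition mutually_independent (R : realType) (d d' : measure_display)
    (T : measurableType d) (P : probability T R) (Omega : measurableType d')
    (N : nat) (X : 'I_N -> {mfun T >-> Omega}) : Prop :=
  forall (J : {set 'I_N}) (A : 'I_N -> set Omega),
    (forall i, measurable (A i)) ->
    P (\bigcap_(i in [set` J]) (X i @^-1` A i)) =
    (\prod_(i in J) P (X i @^-1` A i))%E.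

Definition iid_samples (R : realType) (d d' : measure_display)
    (T : measurableType d) (P : probability T R) (Omega : measurableType d')
    (rho : probability Omega R) (N : nat) (X : 'I_N -> {mfun T >-> Omega}) : Prop :=
  mutually_independent P X /\
  forall i (A : set Omega), measurable A -> distribution P (X i) A = rho A.

(* An empirical minimiser chosen pointwise need not depend measurably on the
   sample, so the event that the generalization error exceeds eps may fail to be
   measurable. Its probability is taken in the outer sense, which agrees with P
   on measurable sets. *)
Definition outer_probability (R : realType) (d : measure_display)
    (T : measurableType d) (P : probability T R) (A : set T) : \bar R :=
  mu_ext P A.

Lemma outer_probabilityE (R : realType) (d : measure_display)
    (T : measurableType d) (P : probability T R) (A : set T) :
  measurable A -> outer_probability P A = P A.
Proof. exact: measurable_mu_extE. Qed.

Definition generalization_error (R : realType) (d : measure_display)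
    (Omega : measurableType d) (rho : probability Omega R) (V : Type)
    (l : V -> Omega -> R) (PhiM PhiMN : V) : R :=
  `|cost rho l PhiM - cost rho l PhiMN|.

(* Main.v *)
Require Import Defs.
From HB Require Import structures.
From mathcomp Require Import all_boot all_order all_algebra.
From mathcomp Require Import all_classical all_reals all_analysis.
From mathcomp Require Import measurable_realfun ring lra.
Set Implicit Arguments.
Unset Strict Implicit.
Unset Printing Implicit Defensive.
Import Order.TTheory GRing.Theory Num.Theory.
Import numFieldNormedType.Exports.
Local Open Scope classical_set_scope.
Local Open Scope ring_scope.

(** Call the cost minus the empirical cost at a model its deviation. Since
    PhiM minimises the cost and PhiMN the empirical cost, a generalization error
    above eps forces the deviations at PhiM and at PhiMN to differ by more than
    eps. The point PhiMN depends on the sample, so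
    the bound delta does not apply to it directly; it is replaced by a point
    taken from a finite net that is fixed in advance.

    Let n be the covering number of M at radius eps / (8 C2). The centres of an
    optimal cover may lie outside M, where delta says nothing, so each centre
    is traded for a point of M in its ball, at the cost of doubling the radius
    ([coverable_inner_net]). Some point y of this net then lies within
    eps / (4 C2) of PhiMN, and both costs are C2-Lipschitz on M
    ([cost_lipschitz], [empirical_cost_lipschitz]), so passing from PhiMN to y
    moves each of them by less than eps / 4. Doubling the radius leaves no room
    for splitting eps evenly between PhiM and PhiMN; the uneven split
    eps = eps / 4 + 3 eps / 4 works: if the deviation at PhiM is at most eps / 4
    in absolute value, the one at PhiMN exceeds 3 eps / 4, hence the one at y
    exceeds 3 eps / 4 - 2 eps / 4 = eps / 4 ([large_deviation_of_excess_cost]). A union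
    bound over PhiM and the n net points gives (n + 1) delta (eps / 4), and
    n + 1 <= 2 n because M is nonempty.

    One point needs care. The Lipschitz hypothesis has an exceptional null set
    for each pair of models, whereas PhiMN ranges over uncountably many models.
    A compact set is separable and the loss is continuous in the model, so a
    single null set serves all pairs ([ae_lipschitz_compact]); it pulls back to
    a null set of samples because every sample has law rho ([ae_all_samples]). *)

(** * Nets and covering numbers of compact sets *)

Lemma compact_net (R : realType) (V : normedModType R) (M : set V) (r : R) :
  compact M -> 0 < r ->
  exists2 s : seq V, (forall y, y \in s -> M y) &
    forall x, M x -> exists2 y, y \in s & ball y r x.
Proof.
move=> cM r0.
have : cover_compact M by rewrite -compact_cover.
move=> /(_ V M (fun y => (ball y r)°)) [].
- by move=> y _; exact: open_interior.
- by move=> y My; exists y => //; exact: nbhsx_ballx.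
- move=> D DM Dcov; exists (finmap.enum_fset D).
    by move=> y /DM; rewrite inE.
  by move=> x /Dcov [y Dy /interior_subset yx]; exists y.
Qed.

Lemma compact_coverable (R : realType) (V : normedModType R) (M : set V)
    (r : R) : compact M -> 0 < r -> exists n, coverable M r n.
Proof.
move=> cM r0; have [s _ scov] := compact_net cM r0.
exists (size s), (tnth (in_tuple s)) => x /scov [y ys yx].
by have /tnthP[i yi] : y \in in_tuple s by []; exists i; rewrite // -yi.
Qed.

(** The infimum is over a nonempty set of natural numbers, hence a minimum. That
    the covering number is finite matters: its product with a vanishing delta
    would be zero even if it were infinite. *)
Lemma covering_number_attained (R : realType) (V : normedModType R)
    (M : set V) (r : R) : (exists n, coverable M r n) ->
  exists2 n, coverable M r n & covering_number M r = n%:R%:E.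
Proof.
move=> [n0 cn0].
have ex : exists n, `[< coverable M r n >] by exists n0; apply/asboolP.
case: (ex_minnP ex) => n /asboolP cn nmin; exists n => //.
apply/eqP; rewrite eq_le; apply/andP; split.
  by apply: ereal_inf_lbound; exists n.
apply: le_ereal_inf_tmp => _ [m cm <-].
by rewrite lee_fin ler_nat nmin//; apply/asboolP.
Qed.

(** The covering balls may be centred outside M. Any point of M in a ball of
    radius r is within 2 r of every other point of that ball, and x0 stands in
    for the balls that miss M. *)
Lemma coverable_inner_net (R : realType) (V : normedModType R) (M : set V)
    (r : R) (n : nat) (x0 : V) : M x0 -> coverable M r n ->
  exists s : seq V, [/\ size s = n, forall y, y \in s -> M y &
    forall x, M x -> exists2 y, y \in s & `|x - y| < r + r].
Proof.
move=> Mx0 [c Mc].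
have /choice[p pP] (i : 'I_n) : exists y, M y /\
    ((exists2 z, M z & ball (c i) r z) -> ball (c i) r y).
  have [[z Mz cz]|cN] := pselect (exists2 z, M z & ball (c i) r z).
    by exists z.
  by exists x0.
exists [seq p i | i <- enum 'I_n]; split.
- by rewrite size_map size_enum_ord.
- by move=> _ /mapP[i _ ->]; exact: (pP i).1.
- move=> x Mx; have [i _ cx] := Mc x Mx.
  exists (p i); first by apply: map_f; rewrite mem_enum.
  have : ball (c i) r (p i) by apply: (pP i).2; exists x.
  move: cx; rewrite -ball_normE /= => cx cp.
  rewrite -(subrKA (c i)) (le_lt_trans (ler_normD _ _))//.
  by rewrite ltrD// distrC.
Qed.

(** * Almost everywhere statements uniform over a compact set *)

(** The union of finite nets of M at radii 1 / (k + 1) is a countable dense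
    subset, so the exceptional sets of its points have a null union; outside of
    it, the closed set where Q holds contains this dense subset, hence M. *)
Lemma ae_forall_compact (R : realType) (V : normedModType R)
    (d : measure_display) (Omega : measurableType d)
    (mu : {measure set Omega -> \bar R}) (M : set V) (Q : V -> Omega -> Prop) :
  compact M -> (forall x, closed [set y | Q y x]) ->
  (forall y, M y -> {ae mu, forall x, Q y x}) ->
  {ae mu, forall x, forall y, M y -> Q y x}.
Proof.
move=> cM clQ aeQ.
have [[y0 My0]|M0] := pselect (exists y, M y); last first.
  by apply: aeW => x y My; case: M0; exists y.
have rpos k : 0 < (k.+1%:R : R)^-1 by [].
have /choice[s sP] k : exists s : seq V, (forall y, y \in s -> M y) /\
    forall x, M x -> exists2 y, y \in s & ball y k.+1%:R^-1 x.
  by have [s sM scov] := compact_net cM (rpos k); exists s.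
have gM k i : M (nth y0 (s k) i).
  have [lti|gei] := ltnP i (size (s k)); last by rewrite nth_default.
  by apply: (sP k).1; exact: mem_nth.
have : {ae mu, forall x, forall k i, Q (nth y0 (s k) i) x}.
  by apply: ae_foralln => k; apply: ae_foralln => i; exact: aeQ.
apply: filterS => x Qx y My; apply: clQ => B /nbhs_ballP[e /= e0 eB].
have [k ke] := ltr_add_invr (e0 : 0 < e).
have [z zs zy] := (sP k).2 y My.
exists z; split.
  by rewrite /= -(nth_index y0 zs); exact: Qx.
apply: eB; apply: ball_sym; apply: le_ball zy.
by apply: ltW; rewrite -[X in X < _]add0r.
Qed.

(** The Lipschitz inequality is a closed condition on each of the two points, so
    density is used once for each of them. *)
Lemma ae_lipschitz_compact (R : realType) (V : normedModType R)
    (d : measure_display) (Omega : measurableType d)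
    (mu : {measure set Omega -> \bar R}) (l : V -> Omega -> R) (M : set V)
    (C : R) :
  compact M -> (forall x, continuous (l ^~ x)) ->
  (forall y z, M y -> M z ->
     {ae mu, forall x, `|l y x - l z x| <= C * `|y - z|}) ->
  {ae mu, forall x, forall y, M y -> forall z, M z ->
     `|l y x - l z x| <= C * `|y - z|}.
Proof.
move=> cM cl lip.
have closed_lip x z : closed [set y | `|l y x - l z x| <= C * `|y - z|].
  rewrite (_ : mkset _ =
    (fun y => C * `|y - z| - `|l y x - l z x|) @^-1` [set t | 0 <= t]).
    apply: closed_comp; last exact: closed_ge.
    move=> y _; apply: cvgB.
      by apply: cvgM; [exact: cvg_cst|apply: cvg_norm; apply: cvgB => //;
        exact: cvg_cst].
    by apply: cvg_norm; apply: cvgB; [exact: cl|exact: cvg_cst].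
  by apply/seteqP; split=> y /=; rewrite subr_ge0.
apply: ae_forall_compact => //.
  move=> x; rewrite (_ : mkset _ =
    \bigcap_(z in M) [set y | `|l y x - l z x| <= C * `|y - z|]).
    by apply: closed_bigI => z _; exact: closed_lip.
  by apply/seteqP; split=> y.
move=> y My.
apply: (@ae_forall_compact _ _ _ _ _ _
  (fun z x => `|l y x - l z x| <= C * `|y - z|)) => //.
- move=> x; rewrite (_ : mkset _ = [set z | `|l z x - l y x| <= C * `|z - y|]).
    exact: closed_lip.
  by apply/seteqP; split=> z /=; rewrite distrC (distrC y).
- by move=> z Mz; exact: lip.
Qed.

(** * Lipschitz continuity of the cost and of the empirical cost *)

Lemma cost_lipschitz (R : realType) (V : normedModType R)
    (d : measure_display) (Omega : measurableType d) (rho : probability Omega R)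
    (l : V -> Omega -> R) (C : R) (y z : V) :
  (forall u, rho.-integrable setT (EFin \o l u)) -> 0 <= C ->
  {ae rho, forall x, `|l y x - l z x| <= C * `|y - z|} ->
  `|cost rho l y - cost rho l z| <= C * `|y - z|.
Proof.
move=> il C0 lip.
have iB : rho.-integrable setT (EFin \o (fun x => l y x - l z x)).
  by have := integrableB measurableT (il y) (il z); exact: eq_integrable.
rewrite /cost -RintegralB//; apply: (le_trans (le_normr_Rintegral _ iB)) => //.
rewrite /Rintegral -lee_fin fineK; last first.
  by apply: integrable_fin_num => //; exact: integrable_norm iB.
rewrite -[leRHS]mule1 -(probability_setT rho).
apply: (integral_le_bound (f := EFin \o (fun x => l y x - l z x))) => //.
- exact: measurable_int iB.
- by rewrite lee_fin mulr_ge0.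
- by apply: filterS lip => x /= + _; rewrite lee_fin.
Qed.

Lemma empirical_cost_lipschitz (R : realType) (Omega : Type)
    (V : normedModType R) (l : V -> Omega -> R) (N : nat) (x : 'I_N -> Omega)
    (C : R) (y z : V) :
  0 <= C -> (forall i, `|l y (x i) - l z (x i)| <= C * `|y - z|) ->
  `|empirical_cost l x y - empirical_cost l x z| <= C * `|y - z|.
Proof.
move=> C0 lip; rewrite /empirical_cost -mulrBr -sumrB normrM.
rewrite ger0_norm ?invr_ge0//.
case: N x lip => [|N] x lip; first by rewrite big_ord0 normr0 mulr0 mulr_ge0.
rewrite ler_pdivrMl// (le_trans (ler_norm_sum _ _ _))//.
rewrite (le_trans (ler_sum _ (fun i _ => lip i)))//.
by rewrite sumr_const card_ord -[leLHS]mulr_natl.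
Qed.

(** * Sampling *)

(** Each sample pulls rho-null sets back to P-null sets, its law being rho. *)
Lemma ae_all_samples (R : realType) (d d' : measure_display)
    (T : measurableType d) (P : probability T R) (Omega : measurableType d')
    (rho : probability Omega R) (N : nat) (X : 'I_N -> {mfun T >-> Omega})
    (Q : Omega -> Prop) :
  (forall i A, measurable A -> distribution P (X i) A = rho A) ->
  {ae rho, forall x, Q x} -> {ae P, forall w, forall i, Q (X i w)}.
Proof.
move=> XP [A [mA A0 QA]]; apply: filter_forall => i.
exists (X i @^-1` A); split.
  by rewrite -[_ @^-1` _]setTI; exact: measurable_funP.
  by rewrite -A0 -(XP i)//.
by move=> w nQ; exact: QA.
Qed.

Lemma measurable_empirical_cost (R : realType) (d d' : measure_display)
    (T : measurableType d) (Omega : measurableType d') (V : Type)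
    (l : V -> Omega -> R) (N : nat) (X : 'I_N -> {mfun T >-> Omega}) (y : V) :
  measurable_fun setT (l y) ->
  measurable_fun setT (fun w => empirical_cost l (fun i => X i w) y).
Proof.
move=> ml; apply: measurable_funM => //; apply: measurable_sum => i.
exact: measurableT_comp.
Qed.

(** J and Jn stand for the cost and the empirical cost at the minimiser of the
    cost, J' and Jn' at the empirical minimiser, Jy and Jny at a nearby net
    point. The identity J' - J = (J' - Jn') + (Jn' - Jn) + (Jn - J), whose middle
    term is nonpositive, gives e < (J' - Jn') - (J - Jn). If `|J - Jn| is at
    most e / 4, then J' - Jn' exceeds 3 e / 4 and loses less than
    e / 4 twice on the way to the net point. *)
Lemma large_deviation_of_excess_cost (R : realFieldType)
    (e J J' Jy Jn Jn' Jny : R) :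
  Jn' <= Jn -> J <= J' -> e < `|J - J'| ->
  `|J' - Jy| < e / 4 -> `|Jn' - Jny| < e / 4 ->
  e / 4 < `|J - Jn| \/ e / 4 < `|Jy - Jny|.
Proof.
move=> h1 h2; rewrite ler0_norm ?subr_le0// => h3.
rewrite !ltr_norml => /andP[h4 h5] /andP[h6 h7].
have [a|a] := ltP (e / 4) `|J - Jn|; first by left.
right; move: a; rewrite ler_norml => /andP[a b].
by rewrite (lt_le_trans _ (ler_norm _))//; lra.
Qed.

Lemma content_bigcup_seq_le (R : realType) (d : measure_display)
    (T : measurableType d) (mu : {content set T -> \bar R}) (I : choiceType)
    (s : seq I) (A : I -> set T) (b : \bar R) :
  (forall i, i \in s -> measurable (A i) /\ (mu (A i) <= b)%E) ->
  (mu (\bigcup_(i in [set` s]) A i) <= \sum_(i <- s) b)%E.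
Proof.
rewrite bigcup_seq; elim: s => [|i s IHs] sA.
  by rewrite !big_nil measure0.
have mAs : measurable (\big[setU/set0]_(j <- s) A j).
  rewrite big_seq_cond; apply: bigsetU_measurable => j /andP[js _].
  by have [] := sA j; rewrite ?inE ?js ?orbT.
have [mAi Aib] := sA i (mem_head _ _).
rewrite !big_cons (le_trans (measureU2 _ _ _))// leeD// IHs// => j js.
by apply: sA; rewrite inE js orbT.
Qed.

(** * The generalization bound *)

Theorem theorem4p12 (R : realType)
    (V : completeNormedModType R) (dot : {dot V for idfun})
    (hV : norm_from_dot dot)
    (d : measure_display) (Omega : measurableType d) (rho : probability Omega R)
    (l : V -> Omega -> R)
    (l_cont : forall x, continuous (fun Phi : V => l Phi x))
    (l_int : forall Phi : V, rho.-integrable setT (EFin \o l Phi))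
    (dT : measure_display) (T : measurableType dT) (P : probability T R)
    (N : nat) (N_gt0 : (0 < N)%N)
    (X : 'I_N -> {mfun T >-> Omega}) (X_iid : iid_samples P rho X)
    (M : set V) (M_compact : compact M)
    (PhiM : V) (PhiM_min : argmin M (cost rho l) PhiM)
    (PhiMN : T -> V)
    (PhiMN_min : forall w, argmin M (empirical_cost l (fun i => X i w)) (PhiMN w))
    (C2 : R) (C2_gt0 : 0 < C2)
    (l_lip : forall Phi1 Phi2 : V, M Phi1 -> M Phi2 ->
      {ae rho, forall x, `|l Phi1 x - l Phi2 x| <= C2 * `|Phi1 - Phi2|})
    (delta : R -> nat -> R)
    (delta_bound : forall (eps : R) (Phi : V), 0 < eps -> M Phi ->
      (P [set w | `|cost rho l Phi - empirical_cost l (fun i => X i w) Phi| > eps]%R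
        <= (delta eps N)%:E)%E)
    (eps : R) (eps_gt0 : 0 < eps) :
  (outer_probability P [set w | generalization_error rho l PhiM (PhiMN w) > eps]%R
    <= 2%:E * covering_number M (eps / (8 * C2)) * (delta (eps / 4) N)%:E)%E.

Proof.
have [M_PhiM minPhi] := PhiM_min.
have r_gt0 : 0 < eps / (8 * C2) by rewrite divr_gt0// mulr_gt0.
have [n cov ->] := covering_number_attained (compact_coverable M_compact r_gt0).
have [s [sn sM snet]] := coverable_inner_net M_PhiM cov.
have n_gt0 : (0 < n)%N.
  by rewrite -sn; have [y] := snet _ M_PhiM; case: (s).
have lipM := ae_lipschitz_compact M_compact l_cont l_lip.
(* The set A is null and measurable and contains every sample for which the
   Lipschitz bound fails for some pair of models. *)
have [A [mA PA0 lipA]] := ae_all_samples X_iid.2 lipM.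
pose D y := [set w |
  `|cost rho l y - empirical_cost l (fun i => X i w) y| > eps / 4].
have mD y : measurable (D y).
  have mdev : measurable_fun setT (fun w =>
      `|cost rho l y - empirical_cost l (fun i => X i w) y|).
    apply: measurableT_comp => //; apply: measurable_funB => //.
    apply: measurable_empirical_cost.
    exact/measurable_EFinP/(measurable_int _ (l_int y)).
  rewrite -[D y]setTI; apply: (measurable_fun_ltr (f := cst (eps / 4)) _ mdev
    measurableT (Y := [set true])) => //.
have e4_gt0 : 0 < eps / 4 by lra.
have PD y : M y -> (P (D y) <= (delta (eps / 4) N)%:E)%E.
  exact: delta_bound.
set b := delta _ _.
have b_ge0 : 0 <= b by rewrite -lee_fin (le_trans _ (PD _ M_PhiM)).
set t := PhiM :: s.
have mU : measurable (\bigcup_(y in [set` t]) D y).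
  by apply: fin_bigcup_measurable.
apply: (@le_trans _ _ (P (A `|` \bigcup_(y in [set` t]) D y))).
  rewrite -outer_probabilityE; last exact: measurableU.
  apply: le_mu_ext => w /= gw.
  have [Aw|Aw] := pselect (A w); first by left.
  right.
  have lw i y z : M y -> M z -> `|l y (X i w) - l z (X i w)| <= C2 * `|y - z|.
    move=> My Mz; apply: contrapT => nle; apply/Aw/lipA => /= /(_ i).
    by move=> /(_ y My z Mz).
  have [Mw minw] := PhiMN_min w.
  have [y ys yw] := snet _ Mw.
  (* eps / (8 C2) was chosen so that C2 times twice the radius is eps / 4. *)
  have C2y : C2 * `|PhiMN w - y| < eps / 4.
    rewrite -ltr_pdivlMl//; apply: (lt_le_trans yw).
    rewrite le_eqVlt; apply/orP; left; apply/eqP; field.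
    by rewrite gt_eqF.
  have My := sM _ ys.
  have := large_deviation_of_excess_cost (minw _ M_PhiM) (minPhi _ Mw) gw
    (le_lt_trans (cost_lipschitz l_int (ltW C2_gt0) (l_lip _ _ Mw My)) C2y)
    (le_lt_trans (empirical_cost_lipschitz (ltW C2_gt0)
      (fun i => lw i _ _ Mw My)) C2y).
  by case=> ?; [exists PhiM|exists y] => //=; rewrite inE ?eqxx// ys orbT.
rewrite (le_trans (measureU2 _ _ _))// [X in (X + _)%E](_ : _ = 0%E)// add0e.
apply: (le_trans (@content_bigcup_seq_le _ _ _ P _ t D b%:E _)).
  move=> y; rewrite inE => /predU1P yt; split=> //; apply: PD.
  by case: yt => [->|/sM].
rewrite sumEFin lee_fin big_const_seq count_predT iter_addr_0 /= sn.
(* There are n + 1 points in t, and n + 1 <= 2 n since n > 0. *)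
rewrite -natrM -[leLHS]mulr_natl ler_wpM2r// ler_nat.
by rewrite mul2n -addnn -addn1 leq_add2l.
Qed.
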